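(* Let $(G_n)_{n\in\mathbb N}$ be a sequence of finite random (multi-)graphs, $G_n$ having vertex set $[n]=\{1,\ldots,n\}$. Let $\mu_n=\frac1n\sum_{i\in[n]}\delta_{\Delta_{i,n}}$ be the quenched friendship-bias empirical distribution of $G_n$, let $\tilde\mu_n(\cdot)=\mathbb E_n[\mu_n(\cdot)]$ be the annealed one, and let $\mu$ be the law of the friendship bias $\Delta_o^{(G)}$ of the root of a rooted random graph $(G,o)$. If $(G_n)_{n\in\mathbb N}$ converges locally in probability to the almost surely locally finite, connected rooted random graph $(G,o)$, then $\mu_n$ converges weakly to $\mu$ in probability as $n\to\infty$, i.e. for every bounded continuous $f\colon\mathbb R\to\mathbb R$, $\int_{\mathbb R} f\,d\mu_n\to\int_{\mathbb R} f\,d\mu$ in probability. In particular, as $n\to\infty$, for every Borel set $A\subseteq\mathbb R$, $$\mu_n(A)\overset{\mathbb P}{\longrightarrow}\mu(A)\qquad\text{and}\qquad \tilde\mu_n(A)\to\mu(A).$$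
   Context: Graphs are undirected and may be multi-graphs. For a graph $G$, $A^{(G)}_{i,j}$ is the number of edges between $i$ and $j$ if $i\ne j$, and twice the number of self-loops at $i$ if $i=j$; $d_i^{(G)}=\sum_j A^{(G)}_{i,j}$ is the degree of $i$. Friendship bias of vertex $i\in[n]$ in $G_n$: $\Delta_{i,n}=\frac{\sum_{j\in[n]}A^{(G_n)}_{i,j}d_j^{(G_n)}}{d_i^{(G_n)}}-d_i^{(G_n)}$ if $d_i^{(G_n)}\neq0$, and $\Delta_{i,n}=0$ if $d_i^{(G_n)}=0$. Friendship bias of the root of a rooted graph $(G,o)$: $\Delta_o^{(G)}=\frac{\sum_{j\in V(G)}A^{(G)}_{o,j}d_j^{(G)}}{d_o^{(G)}}-d_o^{(G)}$ if $d_o^{(G)}\ne0$, and $0$ otherwise. $\mathbb E_n$ is expectation with respect to the random graph $G_n$; $\delta_x$ is the Dirac measure at $x$. Let $\mathscr G$ be the set of connected locally finite rooted graphs, where isomorphic ($\simeq$) rooted graphs are identified. For a rooted graph $(G,o)$, $B_r^{(G)}(o)$ is the rooted subgraph with vertices at graph distance at most $r$ from $o$ and all edges of $G$ both of whose endpoints are within distance $r$ of $o$. Equip $\mathscr G$ with the metric $\mathrm d_{\mathscr G}((G_1,o_1),(G_2,o_2))=\big(1+\sup\{r\ge0: B_r^{(G_1)}(o_1)\simeq B_r^{(G_2)}(o_2)\}\big)^{-1}$. Local convergence in probability: let $U_n$ be a uniformly chosen vertex of $G_n$ and let $\mathscr C(G_n,U_n)$ be the connected component of $U_n$ in $G_n$,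 rooted at $U_n$. $G_n$ converges locally in probability to $(G,o)\in\mathscr G$ with (possibly random) law $\tilde\nu$ if for every bounded continuous $h\colon\mathscr G\to\mathbb R$, $\mathbb E_{\tilde\nu_n}[h(\mathscr C(G_n,U_n))\mid G_n]\to\mathbb E_{\tilde\nu}[h((G,o))]$ in probability, where $\tilde\nu_n$ is the joint law of $(G_n,U_n)$ and $\mathbb E_{\tilde\nu}$ is expectation with respect to $(G,o)$ with law $\tilde\nu$. *)

(* Defs.v *)
From HB Require Import structures.
From mathcomp Require Import all_boot all_order all_algebra.
From mathcomp Require Import generic_quotient.
From mathcomp Require Import all_classical all_reals all_analysis.

Set Implicit Arguments.
Unset Strict Implicit.
Unset Printing Implicit Defensive.

Import Order.TTheory GRing.Theory Num.Theory.
Import numFieldNormedType.Exports.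

Local Open Scope classical_set_scope.
Local Open Scope ring_scope.

(** Vertices are natural numbers: connected locally finite graphs are
    countable, so this loses no isomorphism class of them.  [mult i j] is the
    number of edges joining [i] and [j] and [mult i i] the number of self-loops
    at [i]; the last two fields only say that edges are undirected and join
    vertices of the graph. *)
Record multigraph := Multigraph {
  vertices : set nat;
  mult : nat -> nat -> nat;
  mult_sym : forall i j, mult i j = mult j i;
  mult_vertex : forall i j, (0 < mult i j)%N -> vertices i }.

Definition adj (G : multigraph) (i j : nat) : nat :=
  if i == j then (mult G i i).*2 else mult G i j.

(** Sums over [j \in vertices G] are sums over finite supports; the support is
    finite in the locally finite graphs considered below. *)
Definition degree (G : multigraph) (i : nat) : nat :=
  \big[addn/0%N]_(j \in vertices G) adj G i j.

Definition friendship_bias (R : realType) (G : multigraph) (i : nat) : R :=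
  if degree G i == 0%N then 0
  else (\sum_(j \in vertices G) ((adj G i j)%:R * (degree G j)%:R : R))
         / (degree G i)%:R - (degree G i)%:R.

Definition within_dist (G : multigraph) (u : nat) (r : nat) (v : nat) : Prop :=
  exists p : seq nat, [/\ path (fun i j => 0 < mult G i j)%N u p,
                          last u p = v & (size p <= r)%N].

Definition connected_to (G : multigraph) (u v : nat) : Prop :=
  exists r, within_dist G u r v.

Definition locally_finite (G : multigraph) : Prop :=
  forall v, finite_set [set w | (0 < mult G v w)%N].

Definition induced_mult (G : multigraph) (S : set nat) (i j : nat) : nat :=
  if (i \in S) && (j \in S) then mult G i j else 0%N.

Lemma induced_mult_sym G S i j : induced_mult G S i j = induced_mult G S j i.
Proof. by rewrite /induced_mult andbC mult_sym. Qed.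

Lemma induced_mult_vertex G (S : set nat) i j :
  (0 < induced_mult G S i j)%N -> S i.
Proof. by rewrite /induced_mult; case: ifP => // /andP[/set_mem]. Qed.

Definition induced (G : multigraph) (S : set nat) : multigraph :=
  Multigraph (@induced_mult_sym G S) (@induced_mult_vertex G S).

Definition ball_graph (G : multigraph) (o r : nat) : multigraph :=
  induced G [set v | within_dist G o r v].

Definition rooted_iso (G1 : multigraph) (o1 : nat) (G2 : multigraph) (o2 : nat)
    : Prop :=
  exists f : nat -> nat, [/\ set_bij (vertices G1) (vertices G2) f, f o1 = o2 &
    forall i j, vertices G1 i -> vertices G1 j ->
      mult G2 (f i) (f j) = mult G1 i j].

Record rooted_graph := RootedGraph {
  graph_of :> multigraph;
  root : nat;
  root_vertex : vertices graph_of root;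
  rooted_connected : forall v, vertices graph_of v -> connected_to graph_of root v;
  rooted_locally_finite : locally_finite graph_of }.

Definition riso (x y : rooted_graph) : Prop := rooted_iso x (root x) y (root y).

Lemma rooted_iso_refl G o : rooted_iso G o G o.
Proof.
by exists id; split => //; split => // y Gy; exists y.
Qed.

Lemma rooted_iso_sym G1 o1 G2 o2 : vertices G1 o1 ->
  rooted_iso G1 o1 G2 o2 -> rooted_iso G2 o2 G1 o1.
Proof.
move=> Go1 [f [[f1 f2 f3] fo fm]].
have /choice[g gP] : forall y, exists x, vertices G2 y -> vertices G1 x /\ f x = y.
  move=> y; have [Gy|nGy] := pselect (vertices G2 y); last by exists 0%N.
  by have [x Gx xy] := f3 _ Gy; exists x.
have gf x : vertices G1 x -> g (f x) = x.
  move=> Gx; have [Ggfx e] := gP _ (f1 _ Gx).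
  by apply: f2; rewrite ?inE.
exists g; split.
- split => [y Gy|x y|x Gx].
  + by case: (gP _ Gy).
  + rewrite !inE => Gx Gy e.
    by have [_ <-] := gP _ Gx; have [_ <-] := gP _ Gy; rewrite e.
  + by exists (f x); [exact: f1|exact: gf].
- by rewrite -fo gf.
- move=> i j Gi Gj; have [Gi' {2}<-] := gP _ Gi; have [Gj' {2}<-] := gP _ Gj.
  by rewrite fm.
Qed.

Lemma rooted_iso_trans G1 o1 G2 o2 G3 o3 :
  rooted_iso G1 o1 G2 o2 -> rooted_iso G2 o2 G3 o3 -> rooted_iso G1 o1 G3 o3.
Proof.
move=> [f [[f1 f2 f3] fo fm]] [g [[g1 g2 g3] go gm]].
exists (g \o f); split; last 2 first.
- by rewrite /= fo.
- by move=> i j Gi Gj /=; rewrite gm ?fm//; exact: f1.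
split => [x Gx|x y|z Gz] /=.
- exact/g1/f1.
- rewrite !inE => Gx Gy e; apply: f2; rewrite ?inE//.
  by apply: g2; rewrite ?inE//; exact: f1.
- have [y Gy <-] := g3 _ Gz; have [x Gx <-] := f3 _ Gy.
  by exists x.
Qed.

HB.instance Definition _ := gen_eqMixin rooted_graph.
HB.instance Definition _ := gen_choiceMixin rooted_graph.

Definition risob (x y : rooted_graph) : bool := `[< riso x y >].

Lemma risob_refl : reflexive risob.
Proof. by move=> x; apply/asboolP; exact: rooted_iso_refl. Qed.

Lemma risob_sym : symmetric risob.
Proof.
by move=> x y; apply/asboolP/asboolP; exact/rooted_iso_sym/root_vertex.
Qed.

Lemma risob_trans : transitive risob.
Proof.
by move=> y x z /asboolP xy /asboolP yz; apply/asboolP; exact: rooted_iso_trans yz.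
Qed.

Canonical risob_equiv := EquivRel risob risob_refl risob_sym risob_trans.

Definition ball_iso (x y : rooted_graph) (r : nat) : Prop :=
  rooted_iso (ball_graph x (root x) r) (root x) (ball_graph y (root y) r) (root y).

(** The added [0] makes the supremum of the empty set of radii [0]
    (already the balls of radius [0] may differ, by self-loops at the root);
    the inverse of [+oo] is [0]. *)
Definition local_dist (R : realType) (x y : rooted_graph) : R :=
  fine (1 + ereal_sup (0 |` [set r%:R%:E | r in [set r | ball_iso x y r]]))^-1%E.

Lemma within_dist0 G o r : within_dist G o r o.
Proof. by exists [::]. Qed.

Lemma within_dist0_eq G o v : within_dist G o 0 v -> v = o.
Proof. by move=> [[|a p] []]. Qed.

Lemma ball_iso_refl x r : ball_iso x x r.
Proof. exact: rooted_iso_refl. Qed.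

Lemma ball_iso_sym x y r : ball_iso x y r -> ball_iso y x r.
Proof. by apply: rooted_iso_sym; exact: within_dist0. Qed.

Lemma ball_iso_trans x y z r : ball_iso x y r -> ball_iso y z r -> ball_iso x z r.
Proof. exact: rooted_iso_trans. Qed.

Lemma within_dist_rcons G o r v w :
  within_dist G o r v -> (0 < mult G v w)%N -> within_dist G o r.+1 w.
Proof.
move=> [p [pp pl ps]] vw; exists (rcons p w); split.
- by rewrite rcons_path pp pl.
- by rewrite last_rcons.
- by rewrite size_rcons.
Qed.

Lemma within_distS G o r w : within_dist G o r.+1 w ->
  w = o \/ exists2 v, within_dist G o r v & (0 < mult G v w)%N.
Proof.
move=> [p]; elim/last_ind: p => [[_ /= -> _]|p z _]; first by left.
rewrite rcons_path last_rcons size_rcons => -[/andP[pp pz] <- ps]; right.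
by exists (last o p) => //; exists p.
Qed.

Lemma within_dist_le G o r s v : (r <= s)%N ->
  within_dist G o r v -> within_dist G o s v.
Proof. by move=> rs [p [? ? /leq_trans]] /(_ _ rs); exists p. Qed.

Lemma within_dist_vertex G o r v : vertices G o -> within_dist G o r v ->
  vertices G v.
Proof.
move=> Go; case: r => [|r].
  by move=> /within_dist0_eq ->.
by move=> /within_distS[->//|[u _]]; rewrite mult_sym; exact: mult_vertex.
Qed.

Lemma ball_mult G o r i j : within_dist G o r i -> within_dist G o r j ->
  mult (ball_graph G o r) i j = mult G i j.
Proof.
by move=> Gi Gj; rewrite /= /induced_mult !mem_set.
Qed.

Lemma iso_within (G1 G2 : multigraph) o1 o2 s f :
  f o1 = o2 ->
  {homo f : i / within_dist G1 o1 s i >-> within_dist G2 o2 s i} ->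
  (forall i j, within_dist G1 o1 s i -> within_dist G1 o1 s j ->
     mult G2 (f i) (f j) = mult G1 i j) ->
  forall r i, (r <= s)%N -> within_dist G1 o1 r i -> within_dist G2 o2 r (f i).
Proof.
move=> fo fs fm; elim => [|r ih] i rs.
  by move=> /within_dist0_eq ->; rewrite fo; exact: within_dist0.
move=> Gi; have /within_distS[->|[v Gv vi]] := Gi.
  by rewrite fo; exact: within_dist0.
apply: (within_dist_rcons (ih _ (ltnW rs) Gv)).
rewrite fm//; first exact: within_dist_le (ltnW rs) Gv.
exact: within_dist_le rs Gi.
Qed.

Lemma ball_isoE x y s : ball_iso x y s -> exists f, [/\ f (root x) = root y,
  forall r v, (r <= s)%N -> within_dist x (root x) r v ->
    within_dist y (root y) r (f v),
  forall r w, (r <= s)%N -> within_dist y (root y) r w ->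
    exists2 v, within_dist x (root x) r v & f v = w,
  forall v w, within_dist x (root x) s v -> within_dist x (root x) s w ->
    f v = f w -> v = w &
  forall i j, within_dist x (root x) s i -> within_dist x (root x) s j ->
    mult y (f i) (f j) = mult x i j].
Proof.
move=> [f [[f1 f2 f3] fo fm]].
have fm' i j : within_dist x (root x) s i -> within_dist x (root x) s j ->
    mult y (f i) (f j) = mult x i j.
  move=> xi xj; rewrite -(ball_mult xi xj) -fm// ball_mult//; exact: f1.
have /choice[g gP] : forall w, exists v, within_dist y (root y) s w ->
    within_dist x (root x) s v /\ f v = w.
  move=> w; have [yw|?] := pselect (within_dist y (root y) s w); last by exists 0%N.
  by have [v xv vw] := f3 _ yw; exists v.
have fi v w : within_dist x (root x) s v -> within_dist x (root x) s w ->
    f v = f w -> v = w by move=> xv xw; apply: f2; rewrite ?inE.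
have gf v : within_dist x (root x) s v -> g (f v) = v.
  by move=> xv; have [xg e] := gP _ (f1 _ xv); apply: fi.
exists f; split => //; first exact: iso_within f1 fm'.
move=> r w rs yw; have [_ fg] := gP _ (within_dist_le rs yw); exists (g w) => //.
apply: (@iso_within y x (root y) (root x) s g) yw => //.
- by rewrite -fo gf//; exact: within_dist0.
- by move=> i /gP[].
- move=> i j yi yj; have [xi {2}<-] := gP _ yi; have [xj {2}<-] := gP _ yj.
  by rewrite fm'.
Qed.

Lemma ball_iso_le x y r s : (r <= s)%N -> ball_iso x y s -> ball_iso x y r.
Proof.
move=> rs /ball_isoE[f [fo fw fb fi fm]].
have rle G o v : within_dist G o r v -> within_dist G o s v by exact: within_dist_le.
exists f; split => //; last first.
  move=> i j xi xj; rewrite !ball_mult//; [|exact: fw..].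
  by apply: fm; exact: rle.
split => [v xv|v w|w yw]; first exact: fw.
- by rewrite !inE => xv xw; apply: fi; exact: rle.
- by have [v] := fb _ _ rs yw; exists v.
Qed.

Lemma riso_ball x y r : riso x y -> ball_iso x y r.
Proof.
move=> [f [[f1 f2 f3] fo fm]].
have xV s v : within_dist x (root x) s v -> vertices x v.
  exact/within_dist_vertex/root_vertex.
have yV s v : within_dist y (root y) s v -> vertices y v.
  exact/within_dist_vertex/root_vertex.
have fw s v : within_dist x (root x) s v -> within_dist y (root y) s (f v).
  elim: s v => [|s ih] v.
    by move=> /within_dist0_eq ->; rewrite fo; exact: within_dist0.
  move=> xv; have /within_distS[->|[u xu uv]] := xv.
    by rewrite fo; exact: within_dist0.
  by apply: (within_dist_rcons (ih _ xu)); rewrite fm//; [exact: xV xu|exact: xV xv].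
have fb s w : within_dist y (root y) s w ->
    exists2 v, within_dist x (root x) s v & f v = w.
  elim: s w => [|s ih] w.
    by move=> /within_dist0_eq ->; exists (root x) => //; exact: within_dist0.
  move=> yw; have /within_distS[->|[u /ih[v xv <-] uw]] := yw.
    by exists (root x) => //; exact: within_dist0.
  have [z xz e] := f3 _ (yV _ _ yw); exists z => //.
  apply: (within_dist_rcons xv); rewrite -e fm// in uw; exact: xV xv.
exists f; split => //.
  split => [v|v w|w /fb[v]]; [exact: fw| |by exists v].
  by rewrite !inE => xv xw; apply: f2; rewrite ?inE; [exact: xV xv|exact: xV xw].
move=> i j xi xj; rewrite !ball_mult//; try exact: fw.
by rewrite fm//; [exact: xV xi|exact: xV xj].
Qed.

Lemma ball_finite (x : rooted_graph) r :
  finite_set [set v | within_dist x (root x) r v].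
Proof.
elim: r => [|r ih].
  apply: (@sub_finite_set _ _ [set root x]) => [v|]; last exact: finite_set1.
  by move=> /within_dist0_eq ->.
apply: (@sub_finite_set _ _ (root x |` \bigcup_(v in [set v | within_dist x (root x) r v])
   [set w | (0 < mult x v w)%N])).
  move=> w /= /within_distS[->|[v xv vw]]; first by left.
  by right; exists v.
rewrite finite_setU; split; first exact: finite_set1.
by apply: bigcup_finite => // v _; exact: rooted_locally_finite.
Qed.

Lemma ultra_pigeonhole T (U : set_system T) (h : T -> nat) (A : set nat) :
  UltraFilter U -> finite_set A -> U [set r | A (h r)] ->
  exists2 w, A w & U [set r | h r = w].
Proof.
move=> UU /finite_seqP[s ->]; elim: s => [|a s ih] Uh.
  by case: (filter_not_empty U); apply: filterS Uh => r.
have [Ua|Ua] := in_ultra_setVsetC [set r | h r = a] UU.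
  by exists a => //=; rewrite mem_head.
have [|w sw Uw] := ih; last by exists w => //=; rewrite in_cons (sw : w \in s) orbT.
apply: filterS (filterI Uh Ua) => r [/=]; rewrite in_cons => /orP[/eqP//|//].
Qed.

(** By compactness, as the balls are finite. *)
Lemma ball_iso_riso x y : (forall r, ball_iso x y r) -> riso x y.
Proof.
move=> /(fun H r => ball_isoE (H r))/choice[F FP].
have [U [UU ooU]] := ultraFilterLemma eventually_filter.
have Uge k : U [set r | (k <= r)%N] by apply: ooU; exact: nbhs_infty_ge.
have U2 (Q : Prop) (A : set nat) : U A -> (forall r, A r -> Q) -> Q.
  by move=> /filter_ex[r Ar] /(_ _ Ar).
have xw v : vertices x v -> exists k, within_dist x (root x) k v.
  exact: rooted_connected.
have yw v : vertices y v -> exists k, within_dist y (root y) k v.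
  exact: rooted_connected.
have xV r v : within_dist x (root x) r v -> vertices x v.
  exact/within_dist_vertex/root_vertex.
have yV r v : within_dist y (root y) r v -> vertices y v.
  exact/within_dist_vertex/root_vertex.
have /choice[f fP] : forall v, exists w, vertices x v ->
    vertices y w /\ U [set r | F r v = w].
  move=> v; have [/xw[k xv]|?] := pselect (vertices x v); last by exists 0%N.
  have [|w wy Uw] := ultra_pigeonhole (h := F ^~ v) UU (ball_finite y k).
    apply: filterS (Uge k) => r kr /=.
    by have [_ Fw _ _ _] := FP r; exact: Fw.
  by exists w => _; split => //; exact: yV wy.
have fU v : vertices x v -> U [set r | F r v = f v /\ within_dist x (root x) r v].
  move=> xv; have [_ Uf] := fP _ xv; have [k xk] := xw _ xv.
  by apply: filterS (filterI Uf (Uge k)) => r [Fr kr]; split => //;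
    exact: within_dist_le xk.
exists f; split.
- split => [v /fP[]//|v w|w /[dup] wV /yw[k yk]].
  + rewrite !inE => xv xu fvw.
    apply: U2 (filterI (fU _ xv) (fU _ xu)) _ => r [[Fv xvr] [Fw xwr]].
    by have [_ _ _ Fi _] := FP r; apply: Fi; rewrite // Fv Fw.
  + have /choice[g gP] : forall r, exists v, (k <= r)%N ->
        within_dist x (root x) k v /\ F r v = w.
      move=> r; have [kr|?] := pselect ((k <= r)%N); last by exists 0%N.
      have [_ _ Fb _ _] := FP r.
      by have [v xv Fv] := Fb _ _ kr yk; exists v.
    have [|v xv Uv] := ultra_pigeonhole (h := g) UU (ball_finite x k).
      by apply: filterS (Uge k) => r /gP[].
    exists v; first exact: xV xv.
    apply: U2 (filterI (filterI Uv (Uge k)) (fU _ (xV _ _ xv))) _.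
    by move=> r [[/= <- /gP[_ Fg]] [<- _]].
- apply: U2 (fU _ (root_vertex x)) _ => r [<- _].
  by have [] := FP r.
- move=> i j xi xj.
  apply: U2 (filterI (fU _ xi) (fU _ xj)) _ => r [[<- xir] [<- xjr]].
  by have [_ _ _ _ Fm] := FP r; exact: Fm.
Qed.

Section local_dist.
Context {R : realType}.
Implicit Types x y z : rooted_graph.

Let radius x y : \bar R :=
  ereal_sup (0%E |` [set r%:R%:E | r in [set r | ball_iso x y r]]).

Let radius_ge0 x y : (0 <= radius x y)%E.
Proof. by apply: ereal_sup_ubound; left. Qed.

Let radius_ge x y r : ball_iso x y r -> (r%:R%:E <= radius x y)%E.
Proof. by move=> xy; apply: ereal_sup_ubound; right; exists r. Qed.

Let radius_le x y r : ~ ball_iso x y r -> (radius x y <= r.-1%:R%:E)%E.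
Proof.
move=> xy; apply: ge_ereal_sup => _ [->|[s xys <-]]; rewrite lee_fin// ler_nat.
case: (leqP s r.-1) => // rs; exfalso; apply: xy; apply: ball_iso_le xys.
by case: r rs.
Qed.

Let radius_ultra x y z : (radius x y <= radius y z -> radius x y <= radius x z)%E.
Proof.
move=> h; apply: ge_ereal_sup => _ [->//|[r xy <-]].
have [yz|yz] := pselect (ball_iso y z r).
  exact/radius_ge/(ball_iso_trans xy).
have := le_trans (radius_ge xy) (le_trans h (radius_le yz)).
by rewrite lee_fin ler_nat; case: r {xy yz} => // r; rewrite ltnn.
Qed.

Let radius_sym x y : radius x y = radius y x.
Proof.
rewrite /radius (_ : [set r | ball_iso x y r] = [set r | ball_iso y x r])//.
by apply/seteqP; split => r; exact: ball_iso_sym.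
Qed.

Let inv1D (a : \bar R) : R := fine (1 + a)^-1%E.

Let inv1D_fin (a : R) : 0 <= a -> inv1D a%:E = (1 + a)^-1.
Proof.
move=> a0; rewrite /inv1D -EFinD inver ifF//.
by apply/negbTE/lt0r_neq0; rewrite ltr_wpDr.
Qed.

Let inv1D_ge0 a : (0 <= a)%E -> 0 <= inv1D a.
Proof.
case: a => [a|_|]; last by rewrite leeNy_eq.
  by rewrite lee_fin => a0; rewrite inv1D_fin// invr_ge0 addr_ge0.
by rewrite /inv1D addey// invey.
Qed.

Let inv1D_le a b : (0 <= a)%E -> (a <= b)%E -> inv1D b <= inv1D a.
Proof.
move=> a0; case: b => [b| |]; last by rewrite leeNy_eq => /eqP ->.
- case: a a0 => [a| |]; rewrite ?leye_eq ?leeNy_eq// !lee_fin => a0 ab.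
  rewrite !inv1D_fin ?(le_trans a0)// lef_pV2 ?posrE ?ltr_wpDr ?(le_trans a0)//.
  by rewrite lerD2l.
- by move=> _; rewrite {1}/inv1D addey// invey; exact: inv1D_ge0.
Qed.

Let local_distE x y : local_dist R x y = inv1D (radius x y).
Proof. by []. Qed.

Lemma local_dist_sym x y : local_dist R x y = local_dist R y x.
Proof. by rewrite !local_distE radius_sym. Qed.

Lemma local_dist_eq0 x y : local_dist R x y = 0 <-> riso x y.
Proof.
split => [d0|xy].
  apply: ball_iso_riso => r; apply: contrapT => /radius_le h.
  have := inv1D_le (radius_ge0 x y) h.
  rewrite -local_distE d0 inv1D_fin// leNgt => /negP; apply.
  by rewrite invr_gt0 ltr_wpDr.
rewrite local_distE (_ : radius x y = +oo%E) /inv1D ?addey ?invey//.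
apply/eqyP => a a0; have [n an] : exists n : nat, a <= n%:R.
  by exists (Num.truncn a).+1; rewrite ltW// truncnS_gt.
by rewrite (le_trans _ (radius_ge (riso_ball n xy)))// lee_fin.
Qed.

Lemma local_dist_triangle y x z :
  local_dist R x z <= local_dist R x y + local_dist R y z.
Proof.
rewrite !local_distE; have [h|h] := leP (radius x y) (radius y z).
  rewrite ler_wpDr ?inv1D_ge0// inv1D_le//; exact: radius_ultra.
rewrite ler_wpDl ?inv1D_ge0//; apply: inv1D_le => //.
rewrite (radius_sym y) (radius_sym x).
by apply: radius_ultra; rewrite (radius_sym z) (radius_sym y x) ltW.
Qed.

End local_dist.

Definition local_space (R : realType) : Type := {eq_quot risob}%qT.

Section local_space.
Local Open Scope quotient_scope.
Context (R : realType).

HB.instance Definition _ := Choice.on (local_space R).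

Definition class_of (x : rooted_graph) : local_space R := \pi_{eq_quot risob} x.

Definition representative (x : local_space R) : rooted_graph :=
  repr (x : {eq_quot risob}).

Let eq_class (x y : local_space R) :
  riso (representative x) (representative y) -> x = y.
Proof.
move=> /asboolP xy; rewrite -[x](@reprK _ {eq_quot risob}).
by rewrite -[y](@reprK _ {eq_quot risob}); apply/eqmodP.
Qed.

Definition class_dist (x y : local_space R) : R :=
  local_dist R (representative x) (representative y).

Let class_distxx x : class_dist x x = 0.
Proof. exact/local_dist_eq0/rooted_iso_refl. Qed.

Let class_dist_positivity x y : class_dist x y = 0 -> x = y.
Proof. by move=> /local_dist_eq0/eq_class. Qed.

Let class_dist_sym x y : class_dist x y = class_dist y x.
Proof. exact: local_dist_sym. Qed.

Let class_dist_triangle y x z : class_dist x z <= class_dist x y + class_dist y z.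
Proof. exact: local_dist_triangle. Qed.

HB.instance Definition _ := @isMetric.Build R (local_space R) class_dist
  class_distxx class_dist_positivity class_dist_sym class_dist_triangle.

End local_space.

Record finite_graph (n : nat) := FiniteGraph {
  multigraph_of :> multigraph;
  finite_vertices : vertices multigraph_of = [set i | (0 < i <= n)%N] }.

Lemma finite_graph_locally_finite n (g : finite_graph n) : locally_finite g.
Proof.
move=> v; apply: (@sub_finite_set _ _ `I_n.+1); last exact: finite_II.
move=> w /=; rewrite mult_sym => /mult_vertex.
by rewrite finite_vertices => /andP[_]; rewrite ltnS.
Qed.

Definition component_graph (G : multigraph) (u : nat) : multigraph :=
  induced G [set v | connected_to G u v].

Lemma component_root G u : vertices (component_graph G u) u.
Proof. by exists 0%N, [::]. Qed.

Lemma component_connected G u v : vertices (component_graph G u) v ->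
  connected_to (component_graph G u) u v.
Proof.
move=> [r]; elim: r v => [|r ih] v.
  by move=> /within_dist0_eq ->; exists 0%N, [::].
move=> Gv; have /within_distS[->|[w Gw wv]] := Gv; first by exists 0%N, [::].
have [s sw] := ih _ Gw; exists s.+1; apply: (within_dist_rcons sw).
by rewrite /= /induced_mult !mem_set//; [exists r.+1|exists r].
Qed.

Lemma component_locally_finite G u :
  locally_finite G -> locally_finite (component_graph G u).
Proof.
move=> lfG v; apply: sub_finite_set (lfG v) => w /=.
by rewrite /induced_mult; case: ifP.
Qed.

(** For [u] outside of [[n]] this is an isolated vertex; only [u] in [[n]]
    matter below. *)
Definition component n (g : finite_graph n) (u : nat) : rooted_graph :=
  RootedGraph (component_root g u) (@component_connected g u)
    (component_locally_finite u (@finite_graph_locally_finite n g)).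

Definition empty_multigraph (V : set nat) : multigraph :=
  @Multigraph V (fun _ _ => 0%N) (fun _ _ => erefl) (fun _ _ => ltac:(by [])).

Definition empty_graph n : finite_graph n :=
  @FiniteGraph n (empty_multigraph [set i | (0 < i <= n)%N]) erefl.

HB.instance Definition _ n := gen_eqMixin (finite_graph n).
HB.instance Definition _ n := gen_choiceMixin (finite_graph n).
HB.instance Definition _ n := isPointed.Build (finite_graph n) (empty_graph n).

(** The discrete sigma-algebra, as there are countably many graphs on [[n]]. *)
HB.instance Definition _ n := @isMeasurable.Build default_measure_display
  (finite_graph n) discrete_measurable discrete_measurable0
  discrete_measurableC discrete_measurableU.

HB.instance Definition _ (R : realType) := isPointed.Build (local_space R)
  (class_of R (component (empty_graph 1) 1)).

Definition local_borel (R : realType) :=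
  g_sigma_algebraType (@open (local_space R)).

(** The friendship bias is invariant under isomorphism, so the choice of the
    representative is immaterial. *)
Definition root_bias (R : realType) (x : local_space R) : R :=
  friendship_bias R (representative x) (root (representative x)).

Definition empirical_bias (R : realType) n (g : finite_graph n)
    : {measure set R -> \bar R} :=
  mscale (n%:R^-1)%:nng (msum (fun i => \d_(friendship_bias R g i.+1)) n).

Section random_graphs.
Context {R : realType} {d : measure_display} {Omega : measurableType d}.
Variable P : probability Omega R.
Implicit Types (G : forall n, {RV P >-> finite_graph n})
  (nu : R.-pker Omega ~> local_borel R).

Definition quenched_bias G n (w : Omega) : {measure set R -> \bar R} :=
  empirical_bias R (G n w).

Definition annealed_bias G n (A : set R) : \bar R :=
  \int[P]_w quenched_bias G n w A.

(** The kernel [nu] is the possibly random law of the limiting rooted graph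
    (a nonrandom law is a constant kernel), and [limit_bias nu w] the resulting
    law of the friendship bias of its root. *)
Definition limit_bias nu (w : Omega) : set R -> \bar R :=
  pushforward (nu w) (@root_bias R).

Definition cvg_in_probability (X : nat -> Omega -> R) (Y : Omega -> R) : Prop :=
  forall e : R, 0 < e ->
    P [set w | e < `|X n w - Y w|] @[n --> \oo] --> 0%E.

Definition uniform_vertex n : {measure set nat -> \bar R} :=
  mscale (n%:R^-1)%:nng (msum (fun i => \d_(i.+1)) n).

(** The law of the pair of the random graph [G n] and of a uniform vertex. *)
Definition joint_law G n : set (finite_graph n * nat) -> \bar R :=
  (distribution P (G n) \x uniform_vertex n)%E.

(** Elementary conditional expectation given that the first component is [a];
    graphs on [[n]] being countably many, composing it with the first
    component gives a version of the conditional expectation. *)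
Definition cond_expectation d1 d2 (S : measurableType d1) (T : measurableType d2)
    (Q : set (S * T) -> \bar R) (Y : S * T -> R) (a : S) : R :=
  fine (\int[Q]_(z in [set a] `*` setT) (Y z)%:E)
    / fine (Q ([set a] `*` setT)).

Definition cvg_locally_in_probability G nu : Prop :=
  forall h : local_space R -> R, continuous h ->
    (exists M : R, forall x, `|h x| <= M) ->
    cvg_in_probability
      (fun n w => cond_expectation (@joint_law G n)
         (fun z => h (class_of R (component z.1 z.2))) (G n w))
      (fun w => \int[nu w]_x h x).

End random_graphs.

(* Main.v *)
(** The friendship bias of the root depends only on the ball of radius [2], so
    it is locally constant on the space of rooted graphs. Hence [F \o root_bias]
    is continuous for every function [F] whatsoever, indicators of Borel sets
    included, and all the convergences in probability are instances of the
    hypothesis; the annealed one follows by bounded convergence. *)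
From HB Require Import structures.
Require Import Defs.
From mathcomp Require Import all_boot all_order all_algebra.
From mathcomp Require Import generic_quotient.
From mathcomp Require Import all_classical all_reals all_analysis.
From mathcomp Require Import measurable_realfun lra.

Set Implicit Arguments.
Unset Strict Implicit.
Unset Printing Implicit Defensive.

Import Order.TTheory GRing.Theory Num.Theory.
Import numFieldNormedType.Exports.

Local Open Scope classical_set_scope.
Local Open Scope ring_scope.

(** * The friendship bias as a local quantity *)

Lemma adj_gt0 G i j : (0 < adj G i j)%N -> (0 < mult G i j)%N.
Proof. by rewrite /adj; case: eqP => [->|//]; rewrite double_gt0. Qed.

Lemma adj_eq0 G i j : ~ (0 < mult G i j)%N -> adj G i j = 0%N.
Proof. by case: (posnP (adj G i j)) => // /adj_gt0. Qed.

(** Adjacency numbers vanish off the neighbours of [i], so the sum may be cut down to any set of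
    vertices containing them. With [S] a ball or a component, sums in different graphs become
    comparable. *)
Lemma degree_sub G (S : set nat) i : S `<=` vertices G ->
  (forall j, (0 < mult G i j)%N -> S j) ->
  degree G i = \big[addn/0%N]_(j \in S) adj G i j.
Proof.
move=> SG iS; rewrite /degree; symmetry; apply: fsbig_widen => // j [_ Sj].
by rewrite /= adj_eq0// => /iS.
Qed.

Lemma friendship_bias_sub (R : realType) G (S : set nat) i :
  S `<=` vertices G -> (forall j, (0 < mult G i j)%N -> S j) ->
  friendship_bias R G i =
    if degree G i == 0%N then 0
    else (\sum_(j \in S) ((adj G i j)%:R * (degree G j)%:R : R))
         / (degree G i)%:R - (degree G i)%:R.
Proof.
move=> SG iS; rewrite /friendship_bias; case: ifP => // _; congr (_ / _ - _).
symmetry; apply: fsbig_widen => // j [_ Sj].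
by rewrite /= adj_eq0 ?mul0r// => /iS.
Qed.

(** Radius 2 suffices because the bias reads the degrees of the root's neighbours, whose edges end
    at distance at most 2. *)
Lemma ball_iso_friendship_bias (R : realType) (x y : rooted_graph) :
  ball_iso x y 2 ->
  friendship_bias R x (Defs.root x) = friendship_bias R y (Defs.root y).
Proof.
move=> /ball_isoE[f [fo fw fb fi fm]].
pose Bx := [set v | within_dist x (Defs.root x) 2 v].
pose By := [set v | within_dist y (Defs.root y) 2 v].
have Bxy : set_bij Bx By f.
  split => [v xv|v w|w yw]; first exact: fw.
  - by rewrite !inE; exact: fi.
  - by have [v] := fb _ _ (leqnn 2) yw; exists v.
have xB : Bx `<=` vertices x by move=> v; exact/within_dist_vertex/root_vertex.
have yB : By `<=` vertices y by move=> v; exact/within_dist_vertex/root_vertex.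
have adjE i j : Bx i -> Bx j -> adj y (f i) (f j) = adj x i j.
  move=> xi xj; rewrite /adj; have [->|/eqP ij] := eqVneq i j.
    by rewrite eqxx fm.
  by rewrite ifF ?fm//; apply/eqP => /(fi _ _ xi xj).
have degE v : within_dist x (Defs.root x) 1 v -> degree y (f v) = degree x v.
  move=> xv; have xv2 := within_dist_le (leqnSn 1) xv.
  rewrite (degree_sub xB)//; last by move=> j; exact: within_dist_rcons.
  rewrite (degree_sub yB)//; last first.
    by move=> j; apply: within_dist_rcons; exact: fw xv.
  rewrite (reindex_fsbig f Bx By)//; apply: eq_fsbigr => j /set_mem xj.
  exact: adjE.
have x0 r : within_dist x (Defs.root x) r (Defs.root x) by exact: within_dist0.
have y0 r : within_dist y (Defs.root y) r (Defs.root y) by exact: within_dist0.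
rewrite (friendship_bias_sub R xB)//; last first.
  by move=> j; apply: (@within_dist_rcons _ _ 1 _ _ (x0 1)).
rewrite (friendship_bias_sub R yB)//; last first.
  by move=> j; apply: (@within_dist_rcons _ _ 1 _ _ (y0 1)).
rewrite -fo degE//; case: ifP => // _; congr (_ / _ - _).
rewrite (reindex_fsbig f Bx By)//; apply: eq_fsbigr => j /set_mem xj.
rewrite adjE//; last exact: x0.
(* [degE] covers only distance at most 1; a vertex of the ball further away has adjacency 0 to the
   root, which kills its term. *)
have [->|] := posnP (adj x (Defs.root x) j); first by rewrite !mul0r.
move=> /adj_gt0 xj1; rewrite degE//.
exact: (within_dist_rcons (x0 0%N)).
Qed.

(** A component is closed under adjacency, so passing to it changes neither the degrees nor the
    terms of the bias. *)
Lemma component_friendship_bias (R : realType) n (g : finite_graph n) u :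
  vertices g u ->
  friendship_bias R (component g u) (Defs.root (component g u)) =
    friendship_bias R g u.
Proof.
move=> gu; pose S := [set v | connected_to g u v].
have Su : S u by exists 0%N; exact: within_dist0.
have Sg : S `<=` vertices g by move=> v [r]; exact: within_dist_vertex.
have Sadj v w : S v -> (0 < mult g v w)%N -> S w.
  by move=> [r /within_dist_rcons rv] /rv ?; exists r.+1.
have adjE v w : S v -> S w -> adj (component g u) v w = adj g v w.
  by move=> Sv Sw; rewrite /adj /= /induced_mult !mem_set.
have degE v : S v -> degree (component g u) v = degree g v.
  move=> Sv; rewrite (degree_sub Sg)//; last by move=> w; exact: Sadj.
  by apply: eq_fsbigr => w /set_mem Sw; exact: adjE.
rewrite (friendship_bias_sub R Sg)//; last by move=> w; exact: Sadj.
rewrite /friendship_bias /= degE//; case: ifP => // _; congr (_ / _ - _).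
by apply: eq_fsbigr => w /set_mem Sw; rewrite adjE// degE.
Qed.

(** * The bias on the metric space of rooted graphs *)

Lemma root_bias_class_of (R : realType) (x : rooted_graph) :
  root_bias (class_of R x) = friendship_bias R x (Defs.root x).
Proof.
apply/ball_iso_friendship_bias/riso_ball.
apply/asboolP/(@eqmodP _ risob_equiv).
exact: (@reprK _ {eq_quot risob}%qT).
Qed.

(** If the balls of radius [r] differ, so do all larger ones; the supremum of radii is then at most
    [r], and the distance at least [(1 + r)^-1]. *)
Lemma local_dist_ball_iso (R : realType) (x y : rooted_graph) r :
  local_dist R x y < (1 + r%:R)^-1 -> ball_iso x y r.
Proof.
move=> xy; apply: contrapT => nxy; move: xy; apply/negP; rewrite -leNgt.
rewrite /local_dist; set s := ereal_sup _.
have s0 : (0 <= s)%E by apply: ereal_sup_ubound; left.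
have sr : (s <= r%:R%:E)%E.
  apply: ge_ereal_sup => _ [->|[k xyk <-]]; rewrite lee_fin ?ler_nat//.
  by case: leqP => // /ltnW rk; case: nxy; exact: ball_iso_le xyk.
case: s s0 sr => [s| |]; rewrite ?leye_eq ?leeNy_eq// !lee_fin => s0 sr.
rewrite -EFinD inver ifF; last by apply/negbTE/lt0r_neq0; rewrite ltr_wpDr.
by rewrite /= lef_pV2 ?posrE ?ltr_wpDr ?lerD2l.
Qed.

Lemma near_root_bias (R : realType) (x : local_space R) :
  \forall y \near x, root_bias y = root_bias x.
Proof.
(* Distance below [(1 + 2)^-1] forces the balls of radius 2 to be isomorphic. *)
have : \forall y \near x, ball x ((1 + 2%:R)^-1 : R) y.
  by apply: nbhsx_ballx; rewrite invr_gt0.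
apply: filterS => y xy; symmetry; apply: ball_iso_friendship_bias.
exact: local_dist_ball_iso xy.
Qed.

Lemma continuous_comp_root_bias (R : realType) (F : R -> R) :
  continuous (fun x : local_space R => F (root_bias x)).
Proof.
move=> x; apply: (@cvg_near_cst _ _ _ _ (nbhs x)).
by have := near_root_bias x; apply: filterS => y ->.
Qed.

Lemma open_preimage_root_bias (R : realType) (A : set R) :
  open (@root_bias R @^-1` A).
Proof.
rewrite openE => x Ax; rewrite /interior.
by have := near_root_bias x; apply: filterS => y yx; rewrite /preimage /= yx.
Qed.

(** * Uniform vertices and elementary conditional expectation *)

(** Additivity in the measure settles nonnegative functions; for real [g] the positive and negative
    parts integrate to finite sums of reals, which are subtracted termwise. *)
Lemma integral_average_dirac d (T : measurableType d) (R : realType)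
    (p : nat -> T) (n : nat) (k : {nonneg R}) (g : T -> R) :
  measurable_fun setT g ->
  (\int[mscale k (msum (fun i => \d_(p i)) n)]_x (g x)%:E =
    (k%:num * \sum_(i < n) g (p i))%:E)%E.
Proof.
move=> mg; have mG : measurable_fun setT (EFin \o g) by exact/measurable_EFinP.
have ge0E (f : T -> \bar R) : measurable_fun setT f -> (forall x, 0 <= f x)%E ->
    (\int[mscale k (msum (fun i => \d_(p i)) n)]_x f x =
     k%:num%:E * \sum_(i < n) f (p i))%E.
  move=> mf f0; rewrite ge0_integral_mscale// ge0_integral_measure_sum//.
  by under eq_bigr do rewrite integral_dirac// diracT mul1e.
rewrite integralE !ge0E//; last 2 first.
- exact: measurable_funeneg.
- exact: measurable_funepos.
under eq_bigr do rewrite funeposE -EFin_max.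
under [X in (_ - _ * X)%E]eq_bigr do rewrite funenegE -EFinN -EFin_max.
rewrite !sumEFin -!EFinM -EFinB -mulrBr -sumrB; congr (_ * _)%:E.
apply: eq_bigr => i _; have [h|/ltW h] := leP 0 (g (p i)).
  by rewrite max_r ?oppr_le0// subr0.
by rewrite max_l ?oppr_ge0// sub0r opprK.
Qed.

(** A graph on [[n]] is coded by its finite table of multiplicities: the vertex set being
    prescribed, the table determines the graph. *)
Lemma countable_finite_graph n : countable [set: finite_graph n].
Proof.
pose c (g : finite_graph n) :=
  [ffun ij : 'I_n.+1 * 'I_n.+1 => mult g ij.1 ij.2].
have cI : injective c.
  move=> [[V1 m1 s1 v1] /= e1] [[V2 m2 s2 v2] /= e2] /ffunP ce; subst V1 V2.
  (* Pairs outside the table carry no edge, since edges join vertices and these are at most [n]. *)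
  have mult0 m i j : (forall i j, m i j = m j i) ->
      (forall i j, (0 < m i j)%N -> (0 < i <= n)%N) ->
      ~ (i < n.+1 /\ j < n.+1)%N -> m i j = 0%N.
    move=> ms mv ij; have [//|mij] := posnP (m i j); case: ij; split.
      by have /andP[] := mv _ _ mij.
    by move: mij; rewrite ms => /mv /andP[].
  have mE : m1 = m2.
    apply/funext => i; apply/funext => j.
    have [[hi hj]|nij] := pselect (i < n.+1 /\ j < n.+1)%N.
      by have := ce (Ordinal hi, Ordinal hj); rewrite !ffunE.
    by rewrite (mult0 m1 i j s1 v1 nij) (mult0 m2 i j s2 v2 nij).
  move: s1 v1 s2 v2 {ce}; rewrite mE => s1 v1 s2 v2.
  by rewrite (Prop_irrelevance s1 s2) (Prop_irrelevance v1 v2).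
apply/countable_injP; exists (choice.pickle \o c) => x y _ _ /=.
by move=> /(pcan_inj choice.pickleK)/cI.
Qed.

(** Lets a measure shown finite by its values, such as [uniform_vertex], enter results on products
    of bundled finite measures. *)
Lemma finite_measure_of_fin_num_fun d (T : measurableType d) (R : realType)
    (m : {measure set T -> \bar R}) :
  fin_num_fun m ->
  exists m' : {finite_measure set T -> \bar R}, m' = m :> (set T -> \bar R).
Proof.
case: m => u mu /= mfin; pose M : {measure set T -> \bar R} := Measure.Pack mu.
by exists (HB.pack_for {finite_measure set T -> \bar R} u mu
  (Measure_isFinite.Build _ _ _ M mfin)).
Qed.

Lemma ge0_integral_product_slice d1 d2 (T1 : measurableType d1)
    (T2 : measurableType d2) (R : realType)
    (m1 : {finite_measure set T1 -> \bar R})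
    (m2 : {finite_measure set T2 -> \bar R}) (a : T1) (g : T2 -> \bar R) :
  measurable [set a] -> measurable_fun setT g -> (forall y, 0 <= g y)%E ->
  (\int[m1 \x m2]_(z in [set a] `*` setT) g z.2 =
    m1 [set a] * \int[m2]_y g y)%E.
Proof.
move=> ma mg g0; rewrite integral_mkcond fubini_tonelli1/=; last 2 first.
- apply/(measurable_restrictT _ _).1; first exact: measurableX.
  by apply: measurable_funTS; exact: measurableT_comp.
- by move=> z; rewrite patchE; case: ifP.
transitivity (\int[m1]_(x in [set a]) (\int[m2]_y g y))%E.
  rewrite [RHS]integral_mkcond; apply: eq_integral => x _.
  rewrite /fubini_F patchE; case: ifPn => [/set_mem ->|xa].
    by apply: eq_integral => y _; rewrite patchE mem_set.
  apply: integral0_eq => y _; rewrite patchE ifF//.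
  by apply/negbTE; apply: contra xa; rewrite !inE => -[].
by rewrite integral_cst// muleC.
Qed.

(** By independence the mass of [a] factors out of the numerator and is the whole denominator,
    leaving the integral over the slice. *)
Lemma cond_expectation_product d1 d2 (T1 : measurableType d1)
    (T2 : measurableType d2) (R : realType)
    (m1 : {finite_measure set T1 -> \bar R})
    (m2 : {finite_measure set T2 -> \bar R}) (Y : T1 * T2 -> R) (a : T1) :
  measurable [set a] -> m1 [set a] != 0%E -> m2 setT = 1%E ->
  m2.-integrable setT (fun y => (Y (a, y))%:E) ->
  cond_expectation (m1 \x m2)%E Y a = \int[m2]_y Y (a, y).
Proof.
move=> ma a0 m21 iY; have mY := measurable_int m2 iY.
have mfin : m1 [set a] \is a fin_num by exact: fin_num_measure.
have iYfin := integrable_fin_num measurableT iY.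
have QE : (m1 \x m2)%E ([set a] `*` setT) = m1 [set a].
  by rewrite product_measure1E//= -[RHS]mule1 -m21.
rewrite /cond_expectation QE.
have -> : (\int[m1 \x m2]_(z in [set a] `*` setT) (Y z)%:E =
    m1 [set a] * \int[m2]_y (Y (a, y))%:E)%E.
  (* On the slice [Y] is a function of the second coordinate alone, whose measurability is part of
     [iY]. *)
  transitivity (\int[m1 \x m2]_(z in [set a] `*` setT) (Y (a, z.2))%:E)%E.
    by apply: eq_integral => -[x y]; rewrite inE => -[/= ->].
  rewrite integralE [in RHS]integralE muleBr//; last first.
    by rewrite fin_num_adde_defl// fin_numN integrable_neg_fin_num.
  rewrite -!ge0_integral_product_slice//; last 2 first.
  - exact: measurable_funeneg.
  - exact: measurable_funepos.
  congr (_ - _)%E; apply: eq_integral => z _; first by rewrite !funeposE.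
  by rewrite !funenegE.
by rewrite fineM// mulrAC divff ?mul1r// fine_eq0.
Qed.

Section random_graphs.
Context {R : realType} {d : measure_display} {Omega : measurableType d}.
Context {P : probability Omega R}.
Implicit Types (G : forall n, {RV P >-> finite_graph n}).

Lemma uniform_vertex_setT n : @uniform_vertex R n.+1 setT = 1%E.
Proof.
rewrite /uniform_vertex /= /mscale /= /msum /=.
under eq_bigr do rewrite diracT.
by rewrite sumEFin -EFinM sumr_const card_ord mulVf.
Qed.

Lemma uniform_vertex_fin n : fin_num_fun (@uniform_vertex R n).
Proof.
apply: lty_fin_num_fun; case: n => [|n]; last first.
  by rewrite uniform_vertex_setT ltry.
by rewrite /uniform_vertex /= /mscale /= /msum big_ord0 mule0.
Qed.

(** The joint law is a product, so given a graph of positive probability the vertex is still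
    uniform. *)
Lemma cond_expectation_joint_law G n (Y : finite_graph n.+1 * nat -> R) a :
  P (G n.+1 @^-1` [set a]) != 0%E ->
  cond_expectation (@joint_law _ _ _ P G n.+1) Y a =
    n.+1%:R^-1 * \sum_(i < n.+1) Y (a, i.+1).
Proof.
move=> pa0.
have [U UE] := finite_measure_of_fin_num_fun (uniform_vertex_fin n.+1).
have uE (g : nat -> R) : (\int[U]_i (g i)%:E)%E =
    (n.+1%:R^-1 * \sum_(i < n.+1) g i.+1)%:E.
  by rewrite UE; exact: (@integral_average_dirac _ _ _ S).
rewrite /joint_law -UE.
rewrite (@cond_expectation_product _ _ _ _ _ (distribution P (G n.+1)) U)//.
- by rewrite /Rintegral uE.
- by rewrite UE uniform_vertex_setT.
- apply/integrableP; split; first by [].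
  by under eq_integral do rewrite abse_EFin; rewrite uE ltry.
Qed.

(** On this event [cond_expectation (joint_law G) Y (G n w)] is the junk value
    [0 / 0 = 0] instead of an average over the vertices. *)
Lemma negligible_null_atoms G n :
  P.-negligible [set w | P (G n @^-1` [set G n w]) = 0%E].
Proof.
have /countable_injP[c cI] := countable_finite_graph n.
(* Split by the code of the graph: each of the countably many pieces is empty or lies in the null
   event that [G n] takes one fixed value. *)
apply: (@negligibleS _ _ _ _ (\bigcup_k
   [set w | c (G n w) = k /\ P (G n @^-1` [set G n w]) = 0%E])).
  by move=> w /= w0; exists (c (G n w)).
apply: negligible_bigcup => k.
have [[w0 [<- p0]]|h] := pselect (exists w,
    c (G n w) = k /\ P (G n @^-1` [set G n w]) = 0%E).
  exists (G n @^-1` [set G n w0]); split => //.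
    exact: measurable_funPTI.
  by move=> w /= [/cI ->//]; rewrite inE.
apply: negligibleS (negligible_set0 _) => w /= ww; by apply: h; exists w.
Qed.

End random_graphs.

(** * Measurability and integrability *)

(** Every preimage under [root_bias] is open, hence Borel. *)
Lemma measurable_comp_root_bias (R : realType) d (T : measurableType d)
    (F : R -> T) :
  measurable_fun setT (fun x : local_borel R => F (root_bias x)).
Proof.
move=> _ A _; rewrite setTI; apply: sub_sigma_algebra.
exact: (@open_preimage_root_bias R (F @^-1` A)).
Qed.

Lemma integrable_bounded d (T : measurableType d) (R : realType)
    (mu : {measure set T -> \bar R}) (g : T -> R) (M : R) :
  (mu setT < +oo)%E -> measurable_fun setT g -> (forall x, `|g x| <= M) ->
  mu.-integrable setT (fun x => (g x)%:E).
Proof.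
move=> mufin mg gM; apply: (measurable_bounded_integrable measurableT mufin mg).
exists M; split; first exact: num_real.
by move=> x Mx y _; rewrite /= (le_trans (gM y))// ltW.
Qed.

(** Makes the limit random variable measurable; positive and negative parts reduce it to nonnegative
    kernel integrals. *)
Lemma measurable_Rintegral_kernel d1 d2 (X : measurableType d1)
    (Y : measurableType d2) (R : realType) (k : R.-sfker X ~> Y) (g : Y -> R) :
  measurable_fun setT g -> measurable_fun setT (fun x => \int[k x]_y g y).
Proof.
move=> mg; apply: (@measurableT_comp _ _ _ _ _ _ fine) => //.
have mG : measurable_fun setT (EFin \o g) by exact/measurable_EFinP.
have mI (f : Y -> \bar R) : measurable_fun setT f -> (forall y, 0 <= f y)%E ->
    measurable_fun setT (fun x => \int[k x]_y f y)%E.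
  move=> mf f0.
  apply: (measurable_fun_integral_sfinite_kernel
    (fun z : X * Y => f z.2)) => //.
  exact: measurableT_comp.
under eq_fun do rewrite integralE.
apply: emeasurable_funB; apply: mI => //.
- exact: measurable_funepos.
- exact: measurable_funeneg.
Qed.

(** * Convergence in probability *)

Section in_probability.
Context {R : realType} {d : measure_display} {Omega : measurableType d}.
Context {P : probability Omega R}.

Lemma measurable_deviation (X Y : Omega -> R) (e : R) :
  measurable_fun setT X -> measurable_fun setT Y ->
  measurable [set w | e < `|X w - Y w|].
Proof.
move=> mX mY; have mXY : measurable_fun setT (fun w => `|X w - Y w|).
  apply: (measurableT_comp (@normr_measurable R setT)).
  exact: measurable_funB.
have := measurable_fun_ltr (@measurable_cst _ _ Omega R setT e) mXY measurableT.
by move=> /(_ [set true] I); rewrite setTI.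
Qed.

(** Deviation events of [X'] eventually lie in those of [X] up to a null set. This passes from
    conditional expectations to averages over vertices. *)
Lemma eventually_ae_cvg_in_probability (X X' : nat -> Omega -> R)
    (Y : Omega -> R) :
  (forall n, measurable_fun setT (X n)) ->
  (forall n, measurable_fun setT (X' n)) ->
  measurable_fun setT Y ->
  (\forall n \near \oo, P.-negligible [set w | X' n w != X n w]) ->
  cvg_in_probability P X Y -> cvg_in_probability P X' Y.
Proof.
move=> mX mX' mY XX' XY e e0.
apply: squeeze_cvge (cvg_cst 0%E) (XY e e0).
near=> n; rewrite measure_ge0/=.
have [N [mN N0 XN]] : P.-negligible [set w | X' n w != X n w] by near: n.
have mD := measurable_deviation e (mX n) mY.
apply: (@le_trans _ _ (P ([set w | e < `|X n w - Y w|] `|` N))).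
  apply: le_measure; rewrite ?inE.
  - exact: measurable_deviation.
  - exact: measurableU.
  move=> w /= ew; have [XE|/XN] := eqVneq (X' n w) (X n w); last by right.
  by left; rewrite /= -XE.
by rewrite -[leRHS]adde0 -N0; exact: measureU2.
Unshelve. all: by end_near. Qed.

(** Bounded convergence: where [X n] and [Y] differ by at most [e / 2] the contribution is at most
    [e / 2]; elsewhere it is at most [2 * M] times a probability tending to 0. *)
Lemma cvg_integral_in_probability (X : nat -> Omega -> R) (Y : Omega -> R)
    (M : R) :
  (forall n, measurable_fun setT (X n)) -> measurable_fun setT Y ->
  (forall n w, `|X n w| <= M) -> (forall w, `|Y w| <= M) ->
  cvg_in_probability P X Y ->
  (\int[P]_w (X n w)%:E)%E @[n --> \oo] --> (\int[P]_w (Y w)%:E)%E.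
Proof.
move=> mX mY XM YM XY.
have Pfin : (P setT < +oo)%E by rewrite probability_setT ltry.
have iX n := integrable_bounded Pfin (mX n) (XM n).
have iY := integrable_bounded Pfin mY YM.
rewrite -[X in _ --> X]fineK ?integrable_fin_num//.
apply: cvg_EFin; first by near=> n; exact: integrable_fin_num.
have M0 : 0 <= M by rewrite (le_trans (normr_ge0 (Y point)))// YM.
apply/cvgrPdist_le => /= e e0.
pose D n := [set w | e / 2 < `|X n w - Y w|].
have mD n : measurable (D n) by exact: measurable_deviation.
have e20 : 0 < e / 2 by rewrite divr_gt0.
(* With the probability of [D n] below this number, its share is at most [e / 2]; the added 1 keeps
   the divisor positive when [M] is 0. *)
have eM0 : 0 < e / 2 / (2 * M + 1) by rewrite divr_gt0// ltr_wpDl// mulr_ge0.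
have : fine (P (D n)) @[n --> \oo] --> (0 : R) by exact: fine_cvg (XY _ e20).
move=> /cvgrPdist_le/(_ _ eM0).
apply: filterS => n; rewrite sub0r normrN ger0_norm ?fine_ge0//= => De.
rewrite distrC -RintegralB//; last exact: iX.
have iXY : P.-integrable setT (fun w => (X n w - Y w)%:E).
  apply: (@integrable_bounded _ _ _ _ _ (M + M)) => //.
    exact: measurable_funB.
  by move=> w; rewrite (le_trans (ler_normB _ _))// lerD.
have iD : P.-integrable setT (fun w => (e / 2 + 2 * M * \1_(D n) w)%:E).
  apply: (@integrable_bounded _ _ _ _ _ (e / 2 + 2 * M)) => //.
    by apply: measurable_funD => //; exact: measurable_funM.
  move=> w; rewrite indicE ger0_norm; last first.
    by case: (_ \in _); rewrite ?mulr1 ?mulr0; lra.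
  by case: (_ \in _); rewrite ?mulr1 ?mulr0; lra.
apply: (le_trans (le_normr_Rintegral _ _)) => //.
apply: (@le_trans _ _ (\int[P]_w (e / 2 + 2 * M * \1_(D n) w))).
  apply: le_Rintegral => //.
    by have := integrable_abse iXY.
  move=> w _; rewrite indicE; have [_|] := boolP (w \in D n).
    rewrite mulr1; have := ler_normB (X n w) (Y w).
    by have := XM n w; have := YM w; lra.
  by rewrite notin_setE /D /= => /negP; rewrite -leNgt mulr0 addr0.
rewrite RintegralD//; last 2 first.
- exact: finite_measure_integrable_cst.
- by have := integrableZl measurableT (2 * M) (integrable_indic P (mD n)).
rewrite Rintegral_cst// RintegralZl//; last exact: integrable_indic.
have -> : fine (P setT) = 1 by rewrite probability_setT.
rewrite mulr1 /Rintegral integral_indic// setIT.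
have : fine (P (D n)) * (2 * M + 1) <= e / 2 by rewrite -ler_pdivlMr//; lra.
have : 0 <= fine (P (D n)) by rewrite fine_ge0.
lra.
Unshelve. all: by end_near. Qed.

End in_probability.

(** * Averages of functions of the bias, quenched and limiting *)

Section empirical_average.
Context {R : realType} {d : measure_display} {Omega : measurableType d}.
Context {P : probability Omega R}.
Context (G : forall n, {RV P >-> finite_graph n})
  (nu : R.-pker Omega ~> local_borel R).

Lemma measurable_graph_fun n (F : finite_graph n -> R) :
  measurable_fun setT (fun w => F (G n w)).
Proof.
have mF : measurable_fun setT F by [].
exact: (measurableT_comp mF).
Qed.

(** This is the hypothesis for the test function [F \o root_bias]; it serves continuous functions
    and indicators alike. *)
Lemma cvg_in_probability_average_bias (F : R -> R) (M : R) :
  cvg_locally_in_probability G nu -> (forall x, `|F x| <= M) ->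
  cvg_in_probability P
    (fun n w => n%:R^-1 * \sum_(i < n) F (friendship_bias R (G n w) i.+1))
    (fun w => \int[nu w]_x F (root_bias x)).
Proof.
move=> Gnu FM.
have := Gnu (fun x => F (root_bias x)) (@continuous_comp_root_bias R F)
  (ex_intro _ M (fun x => FM (root_bias x))).
apply: eventually_ae_cvg_in_probability.
- move=> n.
  exact: (measurable_graph_fun (cond_expectation (@joint_law _ _ _ P G n)
    (fun z => F (root_bias (class_of R (component z.1 z.2)))))).
- move=> n; exact: (measurable_graph_fun (fun g =>
    n%:R^-1 * \sum_(i < n) F (friendship_bias R g i.+1))).
- apply: measurable_Rintegral_kernel; exact: measurable_comp_root_bias.
(* At [n = 0] there is no uniform vertex; from 1 on, the two sequences differ only where the graph
   is a null atom. *)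
exists 1%N => // -[//|n] _ /=.
apply: negligibleS (negligible_null_atoms G n.+1) => w /=.
apply: contraNP => /eqP a0.
apply/eqP; rewrite cond_expectation_joint_law//; congr (_ * _).
apply: eq_bigr => i _; rewrite root_bias_class_of component_friendship_bias//=.
by rewrite finite_vertices; exact: ltn_ord.
Qed.

Lemma limit_bias_setT w : nu w setT = 1%E.
Proof. exact: prob_kernel. Qed.

Lemma Rintegral_quenched_bias n w (f : R -> R) : measurable_fun setT f ->
  \int[quenched_bias G n w]_x f x =
    n%:R^-1 * \sum_(i < n) f (friendship_bias R (G n w) i.+1).
Proof.
move=> mf; rewrite /Rintegral.
by rewrite (@integral_average_dirac _ _ _
  (fun i => friendship_bias R (G n w) i.+1)).
Qed.

Lemma quenched_biasE n w (A : set R) :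
  quenched_bias G n w A =
    (n%:R^-1 * \sum_(i < n) \1_A (friendship_bias R (G n w) i.+1))%:E.
Proof.
by rewrite /quenched_bias /empirical_bias /= /mscale /= /msum sumEFin EFinM.
Qed.

Lemma Rintegral_limit_bias w (f : R -> R) (M : R) : measurable_fun setT f ->
  (forall x, `|f x| <= M) ->
  fine (\int[limit_bias nu w]_x (f x)%:E) = \int[nu w]_x f (root_bias x).
Proof.
move=> mf fM; rewrite /limit_bias /Rintegral; congr fine.
rewrite (integral_pushforward (measurable_comp_root_bias id))//.
- exact/measurable_EFinP.
- apply: integrable_bounded.
  + by rewrite limit_bias_setT ltry.
  + exact: measurable_comp_root_bias.
  + by move=> x; exact: fM.
Qed.

Lemma measurable_preimage_root_bias (A : set R) :
  measurable (@root_bias R @^-1` A : set (local_borel R)).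
Proof. by apply: sub_sigma_algebra; exact: open_preimage_root_bias. Qed.

Lemma limit_bias_le1 w (A : set R) : (limit_bias nu w A <= 1)%E.
Proof.
have mA := measurable_preimage_root_bias A.
rewrite -(limit_bias_setT w).
by apply: (@le_measure _ _ _ (nu w)); rewrite ?inE.
Qed.

Lemma limit_biasE w (A : set R) :
  limit_bias nu w A = (\int[nu w]_x \1_A (root_bias x))%:E.
Proof.
have mA := measurable_preimage_root_bias A.
rewrite /Rintegral (integral_indic (nu w) measurableT mA) setIT fineK//.
by rewrite ge0_fin_numE// (le_lt_trans (limit_bias_le1 w A)) ?ltry.
Qed.

End empirical_average.

Lemma norm_indic_le1 (R : realType) T (A : set T) x : `|\1_A x : R| <= 1.
Proof. by rewrite indicE; case: (_ \in _); rewrite ?normr1 ?normr0. Qed.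

Lemma norm_average_le (R : realType) n (x : 'I_n -> R) (M : R) : 0 <= M ->
  (forall i, `|x i| <= M) -> `|n%:R^-1 * \sum_(i < n) x i| <= M.
Proof.
case: n x => [|n] x M0 xM; first by rewrite big_ord0 mulr0 normr0.
rewrite normrM ger0_norm// ler_pdivrMl// (le_trans (ler_norm_sum _ _ _))//.
rewrite mulr_natl -[n.+1 in leRHS]card_ord -sumr_const.
by apply: ler_sum => i _; exact: xM.
Qed.

(** * Quenched and annealed convergence *)

Theorem theorem2p2 (R : realType) (d : measure_display)
    (Omega : measurableType d) (P : probability Omega R)
    (G : forall n : nat, {RV P >-> finite_graph n})
    (nu : R.-pker Omega ~> local_borel R) :
  cvg_locally_in_probability G nu ->
  (forall f : R -> R, continuous f -> (exists M : R, forall x, `|f x| <= M) ->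
     cvg_in_probability P
       (fun n w => \int[quenched_bias G n w]_x f x)
       (fun w => fine (\int[limit_bias nu w]_x (f x)%:E)))
  /\
  (forall A : set R, measurable A ->
     [/\ cvg_in_probability P
           (fun n w => fine (quenched_bias G n w A))
           (fun w => fine (limit_bias nu w A)),
         annealed_bias G n A @[n --> \oo] --> (\int[P]_w limit_bias nu w A)%E &
         forall m : \bar R, {ae P, forall w, limit_bias nu w A = m} ->
           annealed_bias G n A @[n --> \oo] --> m]).
Proof.
move=> Gnu; split=> [f fcont [M fM]|A mA].
  have mf := continuous_measurable_fun fcont.
  have := cvg_in_probability_average_bias Gnu fM.
  congr (cvg_in_probability P _ _).
    by apply/funext => n; apply/funext => w; rewrite Rintegral_quenched_bias.
  by apply/funext => w; rewrite (Rintegral_limit_bias nu w mf fM).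
have XY := cvg_in_probability_average_bias Gnu (norm_indic_le1 R A).
have mY : measurable_fun setT (fun w => \int[nu w]_x \1_A (root_bias x)).
  by apply: measurable_Rintegral_kernel; exact: measurable_comp_root_bias.
(* The annealed mass is the expectation of the quenched one, and all masses lie between 0 and 1, so
   bounded convergence applies. *)
have ann : annealed_bias G n A @[n --> \oo] --> (\int[P]_w limit_bias nu w A)%E.
  rewrite (eq_integral (fun w => (\int[nu w]_x \1_A (root_bias x))%:E));
    last first.
    by move=> w _; exact: limit_biasE.
  rewrite (_ : (fun n => _) = fun n => \int[P]_w (n%:R^-1 *
      \sum_(i < n) \1_A (friendship_bias R (G n w) i.+1))%:E)%E; last first.
    by apply/funext => n; apply: eq_integral => w _; exact: quenched_biasE.
  apply: (@cvg_integral_in_probability _ _ _ P _ _ 1) => //.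
  - move=> n; exact: (measurable_graph_fun G (fun g =>
      n%:R^-1 * \sum_(i < n) \1_A (friendship_bias R g i.+1))).
  - by move=> n w; apply: norm_average_le => // i; exact: norm_indic_le1.
  - move=> w; rewrite ger0_norm; last first.
      by rewrite -lee_fin -limit_biasE; exact: (measure_ge0 (nu w)).
    by rewrite -lee_fin -limit_biasE; exact: limit_bias_le1.
split=> //.
  move: XY; congr (cvg_in_probability P _ _).
    by apply/funext => n; apply/funext => w; rewrite quenched_biasE.
  by apply/funext => w; rewrite limit_biasE.
(* If the limiting mass is almost surely the constant [m], its expectation is [m], as [P] has total
   mass 1. *)
move=> m Ym; rewrite (_ : m = \int[P]_w limit_bias nu w A)%E//.
transitivity (\int[P]_w (cst m w))%E.
  by rewrite integral_cst// -[RHS]/(m * P setT)%E probability_setT mule1.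
apply: ae_eq_integral => //.
- under eq_fun do rewrite limit_biasE; exact/measurable_EFinP.
- by apply: filterS Ym => w -> _.
Qed.
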